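(* Suppose that $d^\xi(v)\le C$ for every scenario $\xi\in[N]$ and customer $v\in V_+$, and let $\hat{\mathcal{Q}}_C$ be the disaggregation of $\mathcal{Q}_C$ along $V_+$ defined in the context. Let $S\subseteq V_+$, $k'\in\mathbb{Z}_{++}$, and define $\mathcal{L}_C(S,k')=\sum_{\xi\in[N]}p_\xi\,\mathcal{L}^{k'}_\xi(0,S)$. Then, for every $\bar x\in\{x\in\mathcal{X}\cap\mathbb{Z}^E: x(E(S))=|S|-k'\}$, $$\sum_{R\in\mathcal{R}(\bar x)}\sum_{v\in S}\hat{\mathcal{Q}}_C(R,v)\ge\mathcal{L}_C(S,k').$$ In particular, if $x(E(S))\le|S|-k'$ is valid for $\mathcal{X}\cap\mathbb{Z}^E$, then $\mathcal{L}_C(S,k')$ is a recourse lower bound for $S$ with respect to $\mathcal{X}(S,k')=\{x\in\mathcal{X}\cap\mathbb{Z}^E: x(E(S))=|S|-k'\}$ and $\hat{\mathcal{Q}}_C$.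
   Context: Setting. $G=(V,E)$ is a complete undirected graph with $V=\{0\}\,\dot\cup\,V_+$, where $0$ is the depot and $V_+$ is the finite set of customers, with edge costs $c\in\mathbb{Q}^E_+$. For $S\subseteq V$, $E(S)$ is the set of edges with both endpoints in $S$ and $\delta(S)$ the set of edges with exactly one endpoint in $S$ ($\delta(v)=\delta(\{v\})$). For a vector or function $f$ and a subset $H$ of its coordinates/domain, $f(H)=\sum_{i\in H}f(i)$. For an integer $a$, $[a]=\{1,\dots,a\}$ if $a>0$ and $[a]=\emptyset$ otherwise. $\mathbb{I}(\cdot)$ is the indicator function. A route is a simple cycle through the depot, written $R=(v_1,\dots,v_\ell)$ with $\ell\ge1$ and distinct customers, with edges $0v_1,v_1v_2,\dots,v_\ell0$ (edge $0v_1$ with multiplicity 2 if $\ell=1$); a sequence and its reversal are the same route. A directed route $\vec R$ is a route with a choice of orientation; $\vec R$ and $\overleftarrow{R}$ are the two orientations. $V_+(R)=\{v_1,\dots,v_\ell\}$, and $\mathbb{1}_R\in\mathbb{Z}^E$ is the characteristic vector of the edge (multi)set. A routing plan is a set of routes whose customer sets partition $V_+$. Let $$\mathcal{X}_{\mathrm{sub}}=\{x\in[0,2]^E : x(\delta(v))=2\ \forall v\in V_+,\ x(E(S))\le|S|-1\ \forall\,\emptyset\ne S\subseteq V_+\}.$$ Each integer $x\in\mathcal{X}_{\mathrm{sub}}$ corresponds to a unique routing plan $\mathcal{R}(x)$ with $x=\sum_{R\in\mathcal{R}(x)}\mathbb{1}_R$. VRPSD with scenarios. Capacity $C\in\mathbb{Q}_{++}$,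 number of vehicles $k\in\mathbb{Z}_{++}$, scenario demand vectors $d^1,\dots,d^N\in\mathbb{Q}^{V_+}_+$ with probabilities $p_1,\dots,p_N\in\mathbb{Q}_+$ summing to one; $\bar d=\sum_\xi p_\xi d^\xi$ has strictly positive entries. The set of first-stage solutions is given by the integer points of $$\mathcal{X}=\mathcal{X}_{\mathrm{cvrp}}=\mathcal{X}_{\mathrm{sub}}\cap\{x: x(\delta(0))=2k,\ x(E(S))\le|S|-\lceil\bar d(S)/C\rceil\ \forall\,\emptyset\ne S\subseteq V_+\}.$$ For a directed route $\vec R=(v_1,\dots,v_\ell)$, $$\mathcal{Q}_C(\vec R)=\sum_{\xi\in[N]}p_\xi\sum_{j\in[\ell]}2c_{0v_j}\sum_{t=1}^\infty\mathbb{I}\Big(\sum_{i\in[j-1]}d^\xi(v_i)\le tC<\sum_{i\in[j]}d^\xi(v_i)\Big),$$ and $\mathcal{Q}_C(R)=\min\{\mathcal{Q}_C(\vec R),\mathcal{Q}_C(\overleftarrow{R})\}$. Disaggregation $\hat{\mathcal{Q}}_C$: for each route $R$, fix an orientation $(v_1,\dots,v_\ell)$ of $R$ attaining the minimum (ties broken in an arbitrary but fixed way), and set $\hat{\mathcal{Q}}_C(R,v_j)=2c_{0v_j}\sum_{\xi\in[N]}p_\xi\sum_{t=1}^\infty\mathbb{I}(\sum_{i\in[j-1]}d^\xi(v_i)\le tC<\sum_{i\in[j]}d^\xi(v_i))$ for $j\in[\ell]$ and $\hat{\mathcal{Q}}_C(R,v)=0$ for $v\in V_+\setminus V_+(R)$.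 For $\alpha,\beta\in\mathbb{R}_+$, $\mathrm{fail}(\alpha,\beta)=\sum_{t=1}^\infty\mathbb{I}(\alpha\le tC<\alpha+\beta)$. For $\nu\in\mathbb{Z}_{++}$, $\alpha\in\mathbb{R}_+$, $\xi\in[N]$ and $S=\{v_1,\dots,v_\ell\}\subseteq V_+$ indexed so that $c_{0v_1}\le\dots\le c_{0v_\ell}$, $$\mathcal{L}^\nu_\xi(\alpha,S)=\sum_{j\in[\mathrm{fail}(\alpha,d^\xi(S))-\nu+1]}2c_{0v_j}.$$ A number $L\in\mathbb{Q}_+$ is a recourse lower bound for $S\subseteq V_+$ with respect to $\mathcal{X}'\subseteq\mathcal{X}\cap\mathbb{Z}^E$ and $\hat{\mathcal{Q}}_C$ if $\sum_{v\in S}\sum_{R\in\mathcal{R}(\bar x)}\hat{\mathcal{Q}}_C(R,v)\ge L$ for all $\bar x\in\mathcal{X}'$. *)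

(* Defs.v *)
From mathcomp Require Import all_boot all_order all_algebra.
Set Implicit Arguments.
Unset Strict Implicit.
Unset Printing Implicit Defensive.
Import Order.TTheory GRing.Theory Num.Theory.
Local Open Scope ring_scope.

(* The customers form a finite type [T]; [None] is the depot. *)
Definition vertex (T : finType) := option T.

Definition edge (T : finType) := {e : {set vertex T} | #|e| == 2}.

Fact depot_edge_subproof (T : finType) (v : T) :
  #|[set None; Some v] : {set vertex T}| == 2.
Proof. by rewrite cards2. Qed.

Definition depot_edge (T : finType) (v : T) : edge T :=
  exist _ [set None; Some v] (depot_edge_subproof v).

Definition edges_in (T : finType) (S : {set vertex T}) : {set edge T} :=
  [set e : edge T | val e \subset S].

Definition cut (T : finType) (S : {set vertex T}) : {set edge T} :=
  [set e : edge T | #|val e :&: S| == 1].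

Definition customers_in (T : finType) (S : {set T}) : {set vertex T} :=
  Some @: S.

(* Only the integral points of the polytopes below are used, so rational
   coordinates lose nothing with respect to real ones. *)
Definition edge_vector (T : finType) := {ffun edge T -> rat}.

Definition vsum (T : finType) (x : edge_vector T) (H : {set edge T}) : rat :=
  \sum_(e in H) x e.

Definition integral (T : finType) (x : edge_vector T) : Prop :=
  forall e, x e \is a Num.int.

Definition X_sub (T : finType) (x : edge_vector T) : Prop :=
  [/\ forall e, 0 <= x e <= 2,
      forall v : T, vsum x (cut [set Some v]) = 2
    & forall S : {set T}, S != set0 ->
        vsum x (edges_in (customers_in S)) <= #|S|%:R - 1].

(* A duplicate-free sequence over [T] has at most [#|T|] items, so the size
   bound only serves to make the type finite. *)
Definition droute (T : finType) :=
  {s : #|T|.-bseq T | uniq s && (0 < size s)%N}.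

Definition stops (T : finType) (s : droute T) : seq T := val (val s).

Fact drev_subproof (T : finType) (s : droute T) :
  uniq (rev_bseq (val s)) && (0 < size (rev_bseq (val s)))%N.
Proof. by rewrite /= rev_uniq size_rev (valP s). Qed.

Definition drev (T : finType) (s : droute T) : droute T :=
  exist _ (rev_bseq (val s)) (drev_subproof s).

(* An undirected route is the set of its two orientations (which coincide when
   there is a single customer). *)
Definition route (T : finType) :=
  {R : {set droute T} | [exists s, R == [set s; drev s]]}.

Definition some_orientation (T : finType) (R : route T) : droute T :=
  xchoose (existsP (valP R)).

Definition route_customers (T : finType) (R : route T) : {set T} :=
  [set v in stops (some_orientation R)].

(* The closed walk 0, v_1, ..., v_l, 0 as the list of its edges; for l = 1 the
   edge 0v_1 is listed twice. *)
Definition walk (T : finType) (s : seq T) : seq {set vertex T} :=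
  [seq [set uv.1; uv.2]
  | uv <- zip (None :: map Some s) (rcons (map Some s) None)].

Definition char_droute (T : finType) (s : droute T) : edge_vector T :=
  [ffun e : edge T => (count_mem (val e) (walk (stops s)))%:R].

Definition char_route (T : finType) (R : route T) : edge_vector T :=
  char_droute (some_orientation R).

Lemma drevK (T : finType) : involutive (@drev T).
Proof. by move=> s; do 2!apply: val_inj; rewrite /= revK. Qed.

Lemma some_orientationP (T : finType) (R : route T) :
  val R = [set some_orientation R; drev (some_orientation R)].
Proof. by apply/eqP; exact: (xchooseP (existsP (valP R))). Qed.

Lemma perm_walk_rev (T : finType) (s : seq T) :
  perm_eq (walk (rev s)) (walk s).
Proof.
have -> : walk (rev s) = rev (walk s); last by rewrite perm_rev.
rewrite /walk -map_rev rev_zip; last by rewrite /= size_rcons.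
rewrite rev_cons rev_rcons -map_rev.
elim: (None :: _) (rcons _ None) => [|a u IH] [|b w] //=.
by rewrite setUC IH.
Qed.

(* The choice made by [some_orientation] is immaterial. *)
Lemma char_routeE (T : finType) (R : route T) (s : droute T) :
  s \in val R -> char_route R = char_droute s.
Proof.
rewrite some_orientationP !inE /char_route => /orP[] /eqP -> //.
apply/ffunP => e; rewrite !ffunE; congr (_ %:R).
by apply/esym/permP; exact: perm_walk_rev.
Qed.

Lemma route_customersE (T : finType) (R : route T) (s : droute T) :
  s \in val R -> route_customers R = [set v in stops s].
Proof.
rewrite some_orientationP !inE /route_customers => /orP[] /eqP -> //.
by apply/setP => v; rewrite !inE /stops /= mem_rev.
Qed.

Definition is_routing_plan (T : finType) (P : {set route T}) : bool :=
  partition [set route_customers R | R in P] [set: T]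
  && dinjectiveb (@route_customers T) P.

(* R(x). The plan exists and is unique for every integral x in [X_sub]; the
   default [set0] is only reached outside of these points. *)
Definition routing_plan (T : finType) (x : edge_vector T) : {set route T} :=
  odflt set0
    [pick P : {set route T} | is_routing_plan P
                              & x == [ffun e => \sum_(R in P) char_route R e]].

Record vrpsd (T : finType) := VRPSD {
  cost : edge_vector T;
  capacity : rat;
  vehicles : nat;
  nb_scenarios : nat;
  demand : 'I_nb_scenarios -> T -> rat;
  prob : 'I_nb_scenarios -> rat;
  cost_ge0 : forall e, 0 <= cost e;
  capacity_gt0 : 0 < capacity;
  vehicles_gt0 : (0 < vehicles)%N;
  demand_ge0 : forall xi v, 0 <= demand xi v;
  prob_ge0 : forall xi, 0 <= prob xi;
  prob_sum1 : \sum_xi prob xi = 1;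
  mean_demand_gt0 : forall v, 0 < \sum_xi prob xi * demand xi v
}.

Arguments demand {T} I xi v : rename.
Arguments prob {T} I xi : rename.

Definition depot_cost (T : finType) (I : vrpsd T) (v : T) : rat :=
  cost I (depot_edge v).

Definition mean_demand (T : finType) (I : vrpsd T) (v : T) : rat :=
  \sum_xi prob I xi * demand I xi v.

Definition X_cvrp (T : finType) (I : vrpsd T) (x : edge_vector T) : Prop :=
  [/\ X_sub x,
      vsum x (cut [set None]) = (2 * vehicles I)%:R
    & forall S : {set T}, S != set0 ->
        vsum x (edges_in (customers_in S))
          <= #|S|%:R
             - (Num.ceil ((\sum_(v in S) mean_demand I v) / capacity I))%:~R].

(* sum_(t >= 1) Ind(a <= t C < b), cut off at an index from which every term
   vanishes; see [nb_multiplesE]. *)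
Definition nb_multiples (C a b : rat) : nat :=
  (\sum_(1 <= t < Num.bound (b / C)) (a <= t%:R * C < b)%R)%N.

Lemma nb_multiplesE (C a b : rat) (m : nat) :
  0 < C -> (Num.bound (b / C) <= m)%N ->
  nb_multiples C a b = (\sum_(1 <= t < m) (a <= t%:R * C < b)%R)%N.
Proof.
move=> C0 lem; rewrite /nb_multiples [RHS](big_cat_nat _ lem) //=.
rewrite [X in (_ + X)%N]big_nat
        [X in (_ + X)%N]big1 ?addn0 // => t /andP[let_ _].
suff -> : (t%:R * C < b) = false by rewrite andbF.
apply/negbTE; rewrite -leNgt -ler_pdivrMr //.
have [b0|b0] := leP 0 (b / C); last by rewrite ltW // (lt_le_trans b0).
by rewrite ltW // (lt_le_trans (archi_boundP b0)) // ler_nat.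
Qed.

Definition fail (C alpha beta : rat) : nat := nb_multiples C alpha (alpha + beta).

(* The position [j] in [s] is counted from 0. *)
Definition failures_at (T : finType) (I : vrpsd T) (xi : 'I_(nb_scenarios I))
    (s : seq T) (j : nat) : nat :=
  nb_multiples (capacity I) (\sum_(v <- take j s) demand I xi v)
                            (\sum_(v <- take j.+1 s) demand I xi v).

Definition Q_droute (T : finType) (I : vrpsd T) (s : droute T) : rat :=
  \sum_xi prob I xi *
    \sum_(j < size (stops s))
      2 * depot_cost I (tnth (in_tuple (stops s)) j)
        * (failures_at xi (stops s) j)%:R.

Definition Q_route (T : finType) (I : vrpsd T) (R : route T) : rat :=
  Num.min (Q_droute I (some_orientation R))
          (Q_droute I (drev (some_orientation R))).

(* A fixed choice, for each route, of an orientation of minimum cost. *)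
Definition optimal_orientation (T : finType) (I : vrpsd T)
    (orient : route T -> droute T) : Prop :=
  forall R, orient R \in val R /\ Q_droute I (orient R) = Q_route I R.

Definition Q_hat (T : finType) (I : vrpsd T) (orient : route T -> droute T)
    (R : route T) (v : T) : rat :=
  let s := stops (orient R) in
  if v \in s then
    2 * depot_cost I v * \sum_xi prob I xi * (failures_at xi s (index v s))%:R
  else 0.

Definition by_depot_cost (T : finType) (I : vrpsd T) (S : {set T}) : seq T :=
  sort (fun u v => depot_cost I u <= depot_cost I v) (enum S).

(* Natural-number subtraction gives the convention [a] = {} for a <= 0. When
   demands are at most the capacity and nu >= 1, the number of terms is at most
   [#|S|], so that [take] does not truncate. *)
Definition L_scenario (T : finType) (I : vrpsd T) (nu : nat)
    (xi : 'I_(nb_scenarios I)) (alpha : rat) (S : {set T}) : rat :=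
  \sum_(v <- take ((fail (capacity I) alpha (\sum_(u in S) demand I xi u)).+1
                     - nu)
                  (by_depot_cost I S))
    2 * depot_cost I v.

Definition L_bound (T : finType) (I : vrpsd T) (S : {set T}) (k' : nat) : rat :=
  \sum_xi prob I xi * L_scenario k' xi 0 S.

Definition X_tight (T : finType) (I : vrpsd T) (S : {set T}) (k' : nat)
    (x : edge_vector T) : Prop :=
  [/\ X_cvrp I x, integral x
    & vsum x (edges_in (customers_in S)) = #|S|%:R - k'%:R].

Definition recourse_lower_bound (T : finType) (I : vrpsd T)
    (orient : route T -> droute T) (S : {set T})
    (X' : edge_vector T -> Prop) (L : rat) : Prop :=
  [/\ 0 <= L,
      forall x, X' x -> X_cvrp I x /\ integral x
    & forall x, X' x ->
        L <= \sum_(v in S) \sum_(R in routing_plan x) Q_hat I orient R v].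

(* Main.v *)
Require Import Defs.
From mathcomp Require Import all_boot all_order all_algebra.
From mathcomp Require Import ring lra.
Import Order.TTheory GRing.Theory Num.Theory.
Local Open Scope ring_scope.

(** The equation [x(E(S)) = |S| - k'] says that the routes of [x] meet [S] in
    exactly [k'] maximal runs of consecutive customers. Fix a scenario. While a
    vehicle serves a run of total demand [b], the cumulated demand sweeps an
    interval of length [b], which contains at least [b / C - 1] multiples of the
    capacity [C], hence the run has that many failures. Summed over the runs, the
    number [F] of failures in [S] satisfies [d(S) <= C * (F + k')]
    ([demand_coverage]), so [F] is at least [fail(0, d(S)) - k' + 1]. Since no
    demand exceeds [C], no customer fails twice, and the failures are paid for at
    [F] distinct customers of [S]; their cost is at least that of the cheapest
    [fail(0, d(S)) - k' + 1] customers ([sum_take_sorted_le]). This is the bound of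
    one scenario ([scenario_bound]); the theorem averages it.

    All this presupposes that [routing_plan x] is a plan that decomposes [x], and
    not the default value. Existence of the decomposition is
    [exists_routing_plan]: starting from one route per customer, routes are merged
    as long as some edge of [x] between customers is missing. *)

(** * Counting multiples of the capacity, and choosing cheap customers *)

(** For [t >= 1], [t * C < D] means [t < ceil (D / C)], so the multiples of [C]
    counted below [D] are exactly those with index up to [ceil (D / C) - 1]. *)
Lemma leq_nb_multiples (C D : rat) (t : nat) :
  0 < C -> 0 <= D -> (0 < t)%N ->
  (t <= nb_multiples C 0 D)%N = (t%:R * C < D).
Proof.
move=> C0 D0 t0.
have cge0 : 0 <= Num.ceil (D / C).
  by rewrite ceil_ge0 (lt_le_trans (ltrN10 _)) // divr_ge0 // ltW.
case En: (Num.ceil (D / C)) cge0 => [n|] // _.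
have multE u : (u%:R * C < D) = (u < n)%N.
  by rewrite -ltr_pdivlMr // -[LHS]/(u%:Z%:~R < D / C) -ceil_gt_int En ltz_nat.
rewrite (@nb_multiplesE C 0 D (maxn (Num.bound (D / C)) n)) ?leq_maxl //.
under eq_big_nat => u _ do
  rewrite mulr_ge0 ?ler0n ?(ltW C0) // multE.
rewrite multE; case: n En multE => [|n] En multE.
  by rewrite big1 // leqNgt t0.
rewrite (@big_cat_nat _ _ _ n.+1) //= ?leq_maxr //.
rewrite (@eq_big_nat _ _ _ _ _ _ (fun _ => 1%N)); last by move=> u /andP[_ ->].
rewrite sum_nat_const_nat muln1 subn1 /= big_nat big1 ?addn0 //.
by move=> u /andP[leu _]; rewrite ltnNge leu.
Qed.

Lemma nb_multiples_le (C D : rat) :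
  0 < C -> 0 <= D -> (nb_multiples C 0 D)%:R * C <= D.
Proof.
move=> C0 D0; case En: (nb_multiples C 0 D) => [|n]; first by rewrite mul0r.
by rewrite ltW // -leq_nb_multiples // En.
Qed.

(** Together with [nb_multiples_le], this brackets [D] between two consecutive
    multiples of [C], which turns bounds on demand into bounds on failures. *)
Lemma nb_multiples_ge (C D : rat) :
  0 < C -> 0 <= D -> D <= (nb_multiples C 0 D)%:R * C + C.
Proof.
move=> C0 D0; rewrite -{3}[C]mul1r -mulrDl natr1.
by rewrite leNgt -leq_nb_multiples // ltnn.
Qed.

Lemma nb_multiplesB (C a b : rat) :
  0 < C -> 0 <= a <= b ->
  (nb_multiples C 0 a + nb_multiples C a b)%N = nb_multiples C 0 b.
Proof.
move=> C0 /andP[a0 leab].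
pose m := maxn (Num.bound (a / C)) (Num.bound (b / C)).
rewrite !(@nb_multiplesE C _ _ m) ?leq_maxl ?leq_maxr // -big_split /=.
apply: eq_bigr => t _; rewrite mulr_ge0 ?ler0n ?(ltW C0) //=.
by case: (ltP (_ * C) a) => [lta|_]; rewrite ?add0n ?(lt_le_trans lta).
Qed.

(** Two distinct multiples of [C] between [a] included and [a + d] excluded would
    force [C < d]. This is why a customer whose demand fits in a vehicle fails at
    most once. *)
Lemma nb_multiples_le1 (C a d : rat) :
  0 < C -> 0 <= a -> 0 <= d <= C -> (nb_multiples C a (a + d) <= 1)%N.
Proof.
move=> C0 a0 /andP[d0 ledC].
have ad0 : 0 <= a + d by rewrite addr_ge0.
rewrite -(leq_add2l (nb_multiples C 0 a)) nb_multiplesB ?a0 ?lerDl // addn1.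
rewrite leqNgt leq_nb_multiples // -leNgt.
apply: (le_trans (lerD (nb_multiples_ge _ _ C0 a0) ledC)).
by rewrite -!natr1 !mulrDl !mul1r.
Qed.

(** Choosing [n] items, each at most once, costs at least as much as the [n]
    cheapest ones. If the cheapest item is not chosen, then [n] items of the tail
    are, and the last of them costs at least as much as the head. *)
Lemma sum_take_sorted_le (U : eqType) (c : U -> rat) (m : U -> nat) (s : seq U)
    (n : nat) :
  (forall v, 0 <= c v) -> (forall v, m v <= 1)%N ->
  sorted (fun u v => c u <= c v) s -> (n <= \sum_(v <- s) m v)%N ->
  \sum_(v <- take n s) c v <= \sum_(v <- s) c v * (m v)%:R.
Proof.
move=> c0 m1; elim: s n => [|v s IH] [|n] sorts lens.
- by rewrite !big_nil.
- by rewrite !big_nil.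
- by rewrite take0 big_nil sumr_ge0 // => u _; rewrite mulr_ge0.
move: lens; rewrite /= !big_cons.
have /= sorts' := path_sorted sorts.
case: (m v) (m1 v) => [|[|//]] _ lens.
  rewrite mulr0 add0r; apply: le_trans (IH _ sorts' lens).
  (* The head is skipped: it is exchanged for the [n]-th item of the tail. *)
  have lts: (n < size s)%N.
    apply: leq_trans lens _; rewrite -sum1_size.
    by apply: leq_sum => u _; exact: m1.
  rewrite (take_nth v) // big_rcons /= [leRHS]addrC lerD2r.
  have /order_path_min/(_ sorts)/allP : transitive (fun u w => c u <= c w).
    by move=> ? ? ?; exact: le_trans.
  by apply; exact: mem_nth.
by rewrite mulr1 lerD2l IH.
Qed.

(** * Edges of the walk along a sequence of stops *)

(** The walk that starts at [u] instead of the depot, visits [s] and returns to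
    the depot: unlike [walk], it is stable under removal of the first stop. *)
Definition walk_from {T : finType} (u : vertex T) (s : seq T) :
    seq {set vertex T} :=
  [seq [set uv.1; uv.2] | uv <- zip (u :: map Some s) (rcons (map Some s) None)].

(** Concatenation replaces the two depot edges [u0] and [0v] by the edge [uv];
    the edges between customers are otherwise unchanged. *)
Lemma count_walk_cat {T : finType} (A : {set vertex T}) (a b : seq T) (u v : T) :
  None \notin A ->
  count_mem A (walk (rcons a u ++ v :: b)) =
    (count_mem A (walk (rcons a u)) + count_mem A (walk (v :: b))
     + (A == [set Some u; Some v]))%N.
Proof.
move=> A0.
have ND w : ([set None; w] == A) = false /\ ([set w; None] == A) = false.
  by split; apply: contraNF A0 => /eqP <-; rewrite !inE eqxx ?orbT.
suff gen p : count_mem A (walk_from p (rcons a u ++ v :: b)) =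
    (count_mem A (walk_from p (rcons a u)) + count_mem A (walk (v :: b))
     + (A == [set Some u; Some v]))%N by exact: gen.
elim: a p => [|w a IH] p /=; last by rewrite IH !addnA.
rewrite (ND _).1 !(ND _).2 [A == _]eq_sym /= !addn0 -[RHS]addnA.
by congr (_ + _)%N; exact: addnC.
Qed.

Lemma mem_walk_depot {T : finType} (s : seq T) (v : T) :
  [set None; Some v] \in walk s -> exists s', s = v :: s' \/ s = rcons s' v.
Proof.
have lastP w s1 : [set None; Some v] \in walk_from (Some w) s1 -> last w s1 = v.
  elim: s1 w => [|w' s1 IH] w; rewrite /walk_from /= in_cons.
    rewrite orbF => /eqP/setP/(_ (Some v)); rewrite !inE eqxx orbF.
    by move=> /esym/eqP[->].
  by case/orP=> [/eqP/setP/(_ None)|/IH//]; rewrite !inE.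
case: s => [|w s]; rewrite /walk /= in_cons.
  by rewrite orbF => /eqP/setP/(_ (Some v)); rewrite !inE eqxx.
case/orP => [/eqP/setP/(_ (Some v))|/lastP <-].
  by rewrite !inE eqxx => /esym/eqP[->]; exists s; left.
by exists (belast w s); right; rewrite -lastI.
Qed.

(** Every two-element entry of the walk is an edge, hence is counted for exactly
    one [e]. *)
Lemma sum_count_walk {T : finType} (p : pred {set vertex T})
    (w : seq {set vertex T}) :
  (\sum_(e : edge T | p (val e)) count_mem (val e) w
    = count (fun A : {set vertex T} => (#|A| == 2) && p A) w)%N.
Proof.
elim: w => [|A w IH] /=; first by rewrite big1.
rewrite big_split /= IH; congr (_ + _)%N.
rewrite -big_mkcondr /= sum1dep_card.
case: (boolP (#|A| == 2)) => [A2|nA2] /=; last first.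
  apply/eqP; rewrite cards_eq0; apply/eqP/setP => e; rewrite !inE.
  by apply/negP => /andP[_ /eqP eA]; rewrite eA (valP e) in nA2.
pose eA : edge T := exist _ A A2.
case: (boolP (p A)) => pA.
  rewrite -[RHS](cards1 eA); apply: eq_card => e; rewrite !inE.
  apply/andP/eqP => [[_ /eqP AE]|->]; last by rewrite /= pA.
  exact: val_inj.
apply/eqP; rewrite cards_eq0; apply/eqP/setP => e; rewrite !inE.
by apply/negP => /andP[pe /eqP eA']; rewrite eA' pe in pA.
Qed.

Lemma card_walk_edge {T : finType} (s : seq T) (A : {set vertex T}) :
  uniq s -> s != [::] -> A \in walk s -> #|A| == 2.
Proof.
move=> us s0.
have gen u s1 : uniq (u :: map Some s1) -> u != None \/ s1 != [::] ->
    A \in walk_from u s1 -> #|A| == 2.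
  elim: s1 u => [|v s1 IH] u /=; rewrite /walk_from /= in_cons.
    move=> _ [u0|//]; rewrite orbF => /eqP ->; by rewrite cards2 u0.
  rewrite inE negb_or => /andP[/andP[uv _] /IH{}IH] _.
  by case/orP => [/eqP->|/IH->//]; [rewrite cards2 uv | left].
apply: (gen None); last by right.
rewrite /= map_inj_uniq ?us; last by move=> ? ? [].
by rewrite andbT; apply/mapP=> -[].
Qed.

(** The vertex [Some v] occurs once as the start and once as the end of a step,
    and in two different steps because consecutive vertices differ. *)
Lemma count_walk_at {T : finType} (s : seq T) (v : T) :
  uniq s -> count (fun A : {set vertex T} => Some v \in A) (walk s) = ((v \in s) * 2)%N.
Proof.
move=> us; rewrite count_map.
rewrite (eq_count (a2 := predU (preim fst (pred1 (Some v)))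
                               (preim snd (pred1 (Some v))))); last first.
  by move=> [a b]; rewrite /= !inE ![Some v == _]eq_sym.
have uS : uniq (map Some s) by rewrite map_inj_uniq // => ? ? [].
have szE : size (None :: map Some s) = size (rcons (map Some s) None).
  by rewrite size_rcons.
have := count_predUI (preim fst (pred1 (Some v))) (preim snd (pred1 (Some v)))
  (zip (None :: map Some s) (rcons (map Some s) None)).
rewrite -2!count_map -/unzip1 -/unzip2 unzip1_zip ?szE // unzip2_zip ?szE //.
rewrite -cats1 count_cat /= addn0 (count_uniq_mem _ uS) mem_map; last by move=>??[].
suff -> : count (predI (preim fst (pred1 (Some v))) (preim snd (pred1 (Some v))))
  (zip (None :: map Some s) (map Some s ++ [:: None])) = 0%N.
  by rewrite !addn0 add0n muln2 -addnn.
(* No step both starts and ends at [v]. *)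
suff gen u : u \notin map Some s -> count (predI (preim fst (pred1 (Some v))) (preim snd (pred1 (Some v))))
  (zip (u :: map Some s) (map Some s ++ [:: None])) = 0%N.
  by apply: gen; apply/mapP=> -[].
elim: s uS u {us szE} => [|w s IH] /= => [_ u _|/andP[ws /IH{}IH] u].
  by rewrite andbF.
rewrite inE negb_or => /andP[uw _].
rewrite IH // addn0; case: eqP => //= uv; by rewrite -uv eq_sym (negPf uw).
Qed.

Definition nb_inside {T : finType} (S : {set T}) (w : seq {set vertex T}) : nat :=
  count (fun A : {set vertex T} => (#|A| == 2) && (A \subset customers_in S)) w.

Lemma nb_inside_walk {T : finType} (s : seq T) :
  uniq s -> s != [::] ->
  (nb_inside [set v in s] (walk s)).+1 = size s.
Proof.
rewrite /nb_inside => us s0.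
have inN (A : {set vertex T}) (S : {set T}) : None \in A -> (A \subset customers_in S) = false.
  by move=> NA; apply/negP=> /subsetP/(_ _ NA)/imsetP[].
suff gen w (s1 : seq T) : uniq (w :: s1) -> {subset w :: s1 <= s} ->
    count (fun A : {set vertex T} => (#|A| == 2) && (A \subset customers_in [set v in s]))
    (walk_from (Some w) s1) = size s1.
  case: s us s0 gen => [//|w s] us _ gen.
  by rewrite /= inN ?inE // andbF add0n /= gen.
elim: s1 w => [|w' s1 IH] w /=; first by rewrite inN ?inE ?eqxx ?orbT ?andbF.
rewrite in_cons negb_or -andbA => /and3P[ww' _ us1] sub.
rewrite IH // => [|x xs]; last by apply: sub; rewrite in_cons xs orbT.
rewrite cards2 (inj_eq Some_inj) ww' subUset !sub1set !mem_imset; try by move=>??[].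
by rewrite !inE !sub // !inE eqxx ?orbT.
Qed.

(** * Demand, runs and failures along one route *)

Definition failures_from {T : finType} (C : rat) (d : T -> rat) (alpha : rat)
    (s : seq T) (v : T) : nat :=
  nb_multiples C (alpha + \sum_(u <- take (index v s) s) d u)
                 (alpha + \sum_(u <- take (index v s).+1 s) d u).

(** The arithmetic of one step of [demand_coverage_from]. Here [b] and [b'] tell
    whether the current vertex and the next stop are in [S], [a] is the demand
    served so far, [g] the number of multiples of [C] below [a], [d] the demand of
    the next stop and [n] its number of failures. *)
Lemma coverage_step (C D a d g n F c i : rat) (b b' : bool) :
  g * C <= a -> a <= g * C + C -> (g + n) * C <= a + d ->
  D <= C * (F + c - i) + (if b' then (g + n) * C + C - (a + d) else 0) ->
  (if b' then d + D else D)
    <= C * (b'%:R * n + F + (b'%:R + c) - ((b && b')%:R + i))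
       + (if b then g * C + C - a else 0).
Proof. case: b; case: b' => /=; lra. Qed.

(** The number of stops in [S] minus the number of edges inside [S] is the number
    of maximal runs of consecutive stops in [S]. A run that spans the cumulated
    demands from [a] to [b] contains at least [(b - a) / C - 1] multiples of [C],
    so each run has demand at most [C] times one plus its number of failures.
    If the walk starts inside [S], its first run continues an earlier one, which
    has already been credited with one unit of [C]; the last summand is the part of
    that credit still available, namely the distance from [alpha] to the next
    multiple of [C]. With this correction the bound passes from the tail of a
    route to the whole route. *)
Lemma demand_coverage_from {T : finType} (S : {set T}) (C : rat) (d : T -> rat)
    (s : seq T) (alpha : rat) (u : vertex T) :
  0 < C -> (forall v, 0 <= d v) -> 0 <= alpha -> uniq (u :: map Some s) ->
  \sum_(v <- s | v \in S) d v
    <= C * ((\sum_(v <- s | v \in S) failures_from C d alpha s v)%:R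
            + (count (mem S) s)%:R - (nb_inside S (walk_from u s))%:R)
       + (if u \in customers_in S
          then (nb_multiples C 0 alpha)%:R * C + C - alpha else 0).
Proof.
move=> C0 d0; elim: s alpha u => [|v s IH] alpha u a0 us.
  rewrite !big_nil /= /walk_from /nb_inside /=.
  have -> : ([set u; None] \subset customers_in S) = false.
    apply/negP=> /subsetP/(_ None); rewrite !inE eqxx orbT => /(_ isT).
    by case/imsetP.
  rewrite andbF addr0 subr0 mulr0 add0r; case: ifP => // _.
  by rewrite subr_ge0 nb_multiples_ge.
have /andP[uvs usv] : (u \notin map Some (v :: s)) && uniq (map Some (v :: s)).
  exact: us.
rewrite map_cons in_cons negb_or in uvs.
case/andP: uvs => uv _.
have ad0 : 0 <= alpha + d v by rewrite addr_ge0.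
have := IH (alpha + d v) (Some v) ad0 usv.
have -> : (Some v \in customers_in S) = (v \in S).
  by rewrite mem_imset // => ? ? [].
have -> : nb_inside S (walk_from u (v :: s)) =
    (((u \in customers_in S) && (v \in S))
     + nb_inside S (walk_from (Some v) s))%N.
  rewrite /nb_inside /= cards2 uv subUset !sub1set [Some v \in _]mem_imset //.
  by move=> ? ? [].
(* Dropping the first stop moves its demand into the offset. *)
have -> : (\sum_(w <- v :: s | w \in S) failures_from C d alpha (v :: s) w)%N =
    ((v \in S) * nb_multiples C alpha (alpha + d v) +
     \sum_(w <- s | w \in S) failures_from C d (alpha + d v) s w)%N.
  rewrite big_cons /failures_from /= eqxx /= take0 big_nil big_seq1 addr0.
  set X := (\sum_(w <- s | _) _)%N; set Y := (\sum_(w <- s | _) _)%N.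
  suff -> : X = Y by case: (v \in S); rewrite ?mul1n ?mul0n ?add0n.
  rewrite /X /Y [LHS]big_seq_cond [RHS]big_seq_cond.
  apply: eq_bigr => w /andP[ws _].
  case: eqP => [vw|_]; last by rewrite /= !big_cons !addrA.
  by case/andP: usv => /mapP[]; exists w; rewrite ?vw.
have le_a : 0 <= alpha <= alpha + d v by rewrite a0 lerDl d0.
rewrite big_cons /= !natrD natrM -(nb_multiplesB C alpha (alpha + d v) C0 le_a).
rewrite natrD => le_s; apply: coverage_step le_s.
- exact: nb_multiples_le.
- exact: nb_multiples_ge.
- by rewrite -natrD nb_multiplesB //; exact: nb_multiples_le.
Qed.

Lemma failures_from_le1 {T : finType} (C : rat) (d : T -> rat) (alpha : rat)
    (s : seq T) (v : T) :
  0 < C -> (forall v, 0 <= d v <= C) -> 0 <= alpha -> v \in s ->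
  (failures_from C d alpha s v <= 1)%N.
Proof.
move=> C0 dC a0 vs.
rewrite /failures_from (take_nth v) ?index_mem // nth_index // big_rcons addrA.
apply: nb_multiples_le1 => //; rewrite addr_ge0 // sumr_ge0 // => w _.
by case/andP: (dC w).
Qed.

(** * Routing plans by counting *)

(** Partitions indexed injectively by routes, in counting form: adding and
    removing routes then amounts to adding and subtracting terms of a sum. *)
Definition covers_once {T : finType} (P : {set route T}) : Prop :=
  forall v : T, (\sum_(R in P) (v \in route_customers R) = 1)%N.

Definition plan_vector {T : finType} (P : {set route T}) : edge_vector T :=
  [ffun e => \sum_(R in P) char_route R e].

Lemma stops_uniq {T : finType} (o : droute T) : uniq (stops o).
Proof. by case/andP: (valP o). Qed.

Lemma stops_neq0 {T : finType} (o : droute T) : stops o != [::].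
Proof. by case/andP: (valP o) => _; rewrite lt0n size_eq0. Qed.

Lemma some_orientation_in {T : finType} (R : route T) :
  some_orientation R \in val R.
Proof. by rewrite some_orientationP !inE eqxx. Qed.

Lemma drev_in {T : finType} {R : route T} {o : droute T} :
  o \in val R -> drev o \in val R.
Proof.
by rewrite some_orientationP !inE => /orP[] /eqP->; rewrite ?drevK eqxx ?orbT.
Qed.

Lemma route_with_stops {T : finType} (s : seq T) :
  uniq s -> s != [::] -> exists R : route T, exists2 o, o \in val R & stops o = s.
Proof.
move=> us s0.
have les : (size s <= #|T|)%N by rewrite -(card_uniqP us) max_card.
have os : uniq (Bseq les) && (0 < size (Bseq les))%N.
  by rewrite us lt0n size_eq0.
pose o : droute T := exist _ (Bseq les) os.
have Ro : [exists o', [set o; drev o] == [set o'; drev o']].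
  by apply/existsP; exists o.
by exists (exist _ [set o; drev o] Ro); exists o; rewrite // !inE eqxx.
Qed.

Lemma route_customers_neq0 {T : finType} (R : route T) :
  exists v, v \in route_customers R.
Proof.
rewrite /route_customers; case: (stops _) (stops_neq0 (some_orientation R)) => [//|v s] _.
by exists v; rewrite !inE eqxx.
Qed.

Lemma covers_once_inj {T : finType} (P : {set route T}) (R1 R2 : route T) (v : T) :
  covers_once P -> R1 \in P -> R2 \in P ->
  v \in route_customers R1 -> v \in route_customers R2 -> R1 = R2.
Proof.
move=> /(_ v) cov P1 P2 v1 v2; apply/eqP; rewrite eq_sym; apply/negPn/negP => R21.
move: cov; rewrite (bigD1 R1) // (bigD1 R2) /=; first by rewrite v1 v2.
by rewrite P2 R21.
Qed.

Lemma routing_planP {T : finType} (P : {set route T}) :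
  is_routing_plan P <-> covers_once P.
Proof.
split=> [/andP[/and3P[/eqP covP /trivIsetP triv _] /dinjectiveP inj] v|cov].
  have : v \in cover [set route_customers R | R in P] by rewrite covP inE.
  case/bigcupP => _ /imsetP[R PR ->] vR.
  rewrite (bigD1 R) //= vR big1 ?addn0 // => R' /andP[PR' neqR].
  apply/eqP; rewrite eqb0; apply: contraNN neqR => vR'; apply/eqP/inj => //.
  apply/eqP/negPn/negP => neqA.
  have /pred0P/(_ v) := triv _ _ (imset_f _ PR') (imset_f _ PR) neqA.
  by rewrite /= vR vR'.
apply/andP; split; last first.
  apply/dinjectiveP => R1 R2 P1 P2 eqR.
  have [v v1] := route_customers_neq0 R1.
  by apply: (@covers_once_inj _ _ _ _ v cov) => //; rewrite -eqR.
apply/and3P; split.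
- apply/eqP/setP => v; rewrite !inE; apply/bigcupP.
  have /eqP/sum_nat_eq1[R [PR vR _]] := cov v.
  by exists (route_customers R); [exact: imset_f | case: (_ \in _) vR].
- apply/trivIsetP => _ _ /imsetP[R1 P1 ->] /imsetP[R2 P2 ->] neqA.
  apply/pred0P => v /=; apply: contraNF neqA => /andP[v1 v2].
  by rewrite (@covers_once_inj _ P R1 R2 v).
- apply/imsetP => -[R PR e0]; have [v] := route_customers_neq0 R.
  by rewrite -e0 inE.
Qed.

Lemma vsum_droute {T : finType} (o : droute T) (p : pred {set vertex T}) :
  vsum (char_droute o) [set e | p (val e)]
    = (count (fun A : {set vertex T} => (#|A| == 2) && p A) (walk (stops o)))%:R.
Proof.
rewrite -sum_count_walk natr_sum /vsum.
by apply: eq_big => [e|e _]; rewrite ?inE ?ffunE.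
Qed.

Lemma vsum_droute_inside {T : finType} (o : droute T) (S : {set T}) :
  vsum (char_droute o) (edges_in (customers_in S))
    = (nb_inside S (walk (stops o)))%:R.
Proof. exact: (vsum_droute o (fun A => A \subset customers_in S)). Qed.

Lemma vsum_plan {T : finType} (P : {set route T}) (H : {set edge T}) :
  vsum (plan_vector P) H = \sum_(R in P) vsum (char_route R) H.
Proof.
by rewrite /vsum exchange_big; apply: eq_bigr => e _; rewrite ffunE.
Qed.

Lemma char_route_ge0 {T : finType} (R : route T) (e : edge T) :
  0 <= char_route R e.
Proof. by rewrite ffunE ler0n. Qed.

Lemma plan_vector_int {T : finType} (P : {set route T}) : integral (plan_vector P).
Proof.
move=> e; rewrite ffunE rpred_sum // => R _.
by rewrite ffunE intr_nat.
Qed.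

Lemma card_setI_customer {T : finType} (A : {set vertex T}) (v : T) :
  (#|A :&: [set Some v]| == 1%N) = (Some v \in A).
Proof.
have [vA|vA] := boolP (Some v \in A).
  by rewrite (setIidPr _) ?sub1set ?cards1.
rewrite (_ : _ :&: _ = set0) ?cards0 //; apply/eqP.
by rewrite setI_eq0 disjoint_sym disjoints1.
Qed.

Lemma plan_degree {T : finType} (P : {set route T}) (v : T) :
  covers_once P -> vsum (plan_vector P) (cut [set Some v]) = 2.
Proof.
move=> cov; transitivity (((\sum_(R in P) (v \in route_customers R)) * 2)%:R : rat).
  rewrite big_distrl natr_sum vsum_plan; apply: eq_bigr => R _.
  rewrite (vsum_droute _ (fun A => #|A :&: [set Some v]| == 1%N)).
  rewrite inE; congr (_ %:R).
  rewrite -[RHS]count_walk_at ?stops_uniq //; apply: eq_in_count => A /card_walk_edge.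
  by rewrite stops_uniq stops_neq0 card_setI_customer => /(_ isT isT) ->.
by rewrite cov.
Qed.

Lemma depot_edge_of {T : finType} (e : edge T) :
  None \in val e -> exists v, e = depot_edge v.
Proof.
have /cards2P[[a|] [[b|] [neqab eE]]] := valP e; rewrite eE !inE // => _.
  by exists a; apply: val_inj; rewrite eE /= setUC.
by exists b; apply: val_inj; rewrite eE.
Qed.

(** The edges at [v] are its depot edge and edges between customers. Two vectors
    of degree 2 that agree between customers therefore agree everywhere. *)
Lemma vsum_cut {T : finType} (x : edge_vector T) (v : T) :
  vsum x (cut [set Some v])
    = x (depot_edge v)
      + \sum_(e : edge T | (Some v \in val e) && (None \notin val e)) x e.
Proof.
have inc e : (e \in cut [set Some v]) = (Some v \in val e).
  by rewrite inE card_setI_customer.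
rewrite /vsum (bigD1 (depot_edge v)) ?inc ?inE ?eqxx ?orbT //=.
congr (_ + _); apply: eq_bigl => e; rewrite inc; apply: andb_id2l => ve.
congr (~~ _).
apply/eqP/idP => [->|/depot_edge_of[w ew]]; first by rewrite !inE.
by move: ve; rewrite ew !inE => /eqP[->].
Qed.

(** A stop adjacent to the depot is the first or the last one; the orientation
    can be chosen so that it is the last. *)
Lemma route_depot_edge {T : finType} (R : route T) (v : T) :
  char_route R (depot_edge v) != 0 ->
  exists2 o, o \in val R & exists s, stops o = rcons s v.
Proof.
rewrite ffunE pnatr_eq0 -lt0n -has_count has_pred1 => /mem_walk_depot[s [sE|sE]].
  exists (drev (some_orientation R)); first by rewrite drev_in ?some_orientation_in.
  by exists (rev s); rewrite /stops /= -/(stops _) sE rev_cons.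
by exists (some_orientation R); [exact: some_orientation_in | exists s].
Qed.

(** Orient [R1] so that it ends at [u] and [R2] so that it starts at [v], and
    concatenate. *)
Lemma merge_routes {T : finType} (P : {set route T}) (R1 R2 : route T) (u v : T) :
  covers_once P -> R1 \in P -> R2 \in P -> R1 != R2 ->
  char_route R1 (depot_edge u) != 0 -> char_route R2 (depot_edge v) != 0 ->
  exists P' : {set route T}, [/\ covers_once P', (#|P'| < #|P|)%N &
    forall e : edge T, None \notin val e ->
      plan_vector P' e
        = plan_vector P e + (val e == [set Some u; Some v])%:R].
Proof.
move=> cov P1 P2 neqR /route_depot_edge[o1 R1o [a o1E]].
case/route_depot_edge=> [o2' /drev_in R2o [b o2'E]].
set o2 := drev o2' in R2o; have {o2'E} o2E : stops o2 = v :: rev b.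
  by rewrite /stops /= -/(stops _) o2'E rev_rcons.
have c1 := route_customersE R1o; have c2 := route_customersE R2o.
have us : uniq (stops o1 ++ stops o2).
  rewrite cat_uniq !stops_uniq andbT /=; apply/hasPn => w w2.
  apply: contraNN neqR => w1; apply/eqP.
  by apply: (@covers_once_inj _ P _ _ w cov); rewrite ?c1 ?c2 ?inE.
have [|R [o Ro oE]] := route_with_stops _ us.
  by rewrite o1E; case: (a).
have c := route_customersE Ro.
(* A route of [P] through both [u] and [v] would be equal to [R1] and to [R2]. *)
have RnP : R \notin P.
  apply: contraNN neqR => PR; apply/eqP; transitivity R.
    apply: (@covers_once_inj _ P _ _ u cov) => //.
      by rewrite c1 o1E inE mem_rcons inE eqxx.
    by rewrite c oE inE mem_cat o1E mem_rcons inE eqxx.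
  apply: (@covers_once_inj _ P _ _ v cov) => //.
    by rewrite c oE inE mem_cat o2E inE eqxx orbT.
  by rewrite c2 o2E !inE eqxx.
pose P0 := P :\ R1 :\ R2.
have P2' : R2 \in P :\ R1 by rewrite !inE eq_sym neqR.
have RnP0 : R \notin P0 by rewrite !inE (negPf RnP) !andbF.
exists (R |: P0); split.
- move=> w; rewrite big_setU1 //= -[RHS](cov w) (big_setD1 R1 P1) (big_setD1 R2 P2') /=.
  rewrite addnA; congr (_ + _)%N; rewrite c c1 c2 !inE oE mem_cat.
  move: us; rewrite cat_uniq => /and3P[_ /hasPn/(_ w) w12 _].
  by case: (w \in stops o2) w12 => [/(_ isT)/= /negPf->|_]; rewrite ?orbF ?addn0.
- by rewrite cardsU1 RnP0 (cardsD1 R1 P) P1 (cardsD1 R2 (P :\ R1)) P2'.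
- move=> e e0; rewrite !ffunE big_setU1 //= (big_setD1 R1 P1) (big_setD1 R2 P2') /=.
  rewrite (char_routeE Ro) (char_routeE R1o) (char_routeE R2o) !ffunE oE o1E o2E.
  by rewrite count_walk_cat // !natrD; ring.
Qed.

(** The plan with one out-and-back route per customer. *)
Lemma exists_singleton_plan (T : finType) : exists P : {set route T},
  covers_once P /\ forall e : edge T, None \notin val e -> plan_vector P e = 0.
Proof.
have [r rE] : exists r : T -> route T,
    forall v, exists2 o, o \in val (r v) & stops o = [:: v].
  pose good v (R : route T) := exists2 o, o \in val R & stops o = [:: v].
  apply: (@fin_all_exists _ (fun=> route T) good) => v; exact: route_with_stops.
have rc v : route_customers (r v) = [set v].
  by have [o ro oE] := rE v; rewrite (route_customersE ro) oE; apply/setP => w; rewrite !inE.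
have rI : {in predT &, injective r}.
  by move=> v w _ _ e; apply/set1P; rewrite -rc -e rc set11.
exists (r @: predT); split=> [v|e e0].
  rewrite big_imset //= (bigD1 v) //= rc set11 big1 // => w neqw.
  by rewrite rc inE eq_sym (negPf neqw).
rewrite ffunE big_imset //= big1 // => v _; have [o ro oE] := rE v.
rewrite (char_routeE ro) ffunE oE; apply/eqP; rewrite pnatr_eq0; apply/eqP.
apply/count_memPn; apply: contraNN e0; rewrite /walk /= !inE.
by move=> /orP[]/eqP->; rewrite !inE ?orbT.
Qed.

(** * Existence of the routing plan *)

(** Both vectors have degree 2 at [v]: what the plan misses on an edge [e] between
    customers, it must spend on the depot edge of [v]. *)
Lemma deficient_depot_edge {T : finType} (x : edge_vector T) (P : {set route T})
    (e : edge T) (v : T) :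
  X_sub x -> covers_once P ->
  (forall e' : edge T, None \notin val e' -> plan_vector P e' <= x e') ->
  None \notin val e -> Some v \in val e -> plan_vector P e < x e ->
  exists2 R, R \in P & char_route R (depot_edge v) != 0.
Proof.
move=> [x02 deg _] cov lePx e0 ve lt_e.
have : x (depot_edge v) < plan_vector P (depot_edge v).
  have := deg v; rewrite -(plan_degree P v cov) !vsum_cut.
  have lt_sum : \sum_(e' : edge T | (Some v \in val e') && (None \notin val e'))
        plan_vector P e'
      < \sum_(e' : edge T | (Some v \in val e') && (None \notin val e')) x e'.
    rewrite [ltLHS](bigD1 e) ?ve //= [ltRHS](bigD1 e) ?ve //=.
    rewrite ltr_leD //; apply: ler_sum => e' /andP[/andP[_ ?] _]; exact: lePx.
  set X := \sum_(e' | _) x e' in lt_sum * => degE.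
  by rewrite -(ltrD2r X) degE ltrD2l.
have /andP[x0 _] := x02 (depot_edge v) => /(le_lt_trans x0).
rewrite ffunE => lt0; apply/exists_inP; apply: contraTT lt0.
rewrite negb_exists_in => /forall_inP allz.
by rewrite big1 ?ltxx // => R /allz/negPn/eqP.
Qed.

(** Take a plan with as few routes as possible among those that use no edge
    between customers more often than [x]; singleton routes show that there is one.
    If some edge [uv] between customers were used less often than in [x], then [u]
    and [v] would be adjacent to the depot in the plan. If they lie on two routes,
    merging these along [uv] contradicts minimality. If they lie on one route with
    set of customers [S], then the plan already has [|S| - 1] edges inside [S] and
    [x] has more, against the subtour inequality. So the plan agrees with [x]
    between customers, and then also on depot edges by the degree equations. *)
Lemma exists_routing_plan {T : finType} (x : edge_vector T) :
  X_sub x -> integral x ->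
  exists2 P : {set route T}, covers_once P & x = plan_vector P.
Proof.
move=> xsub xint; have [x02 deg sub] := xsub.
pose good (P : {set route T}) :=
  [forall v, (\sum_(R in P) (v \in route_customers R))%N == 1%N]
  && [forall e : edge T, (None \notin val e) ==> (plan_vector P e <= x e)].
have [P0 [cov0 z0]] := exists_singleton_plan T.
have good0 : good P0.
  apply/andP; split; first by apply/forallP => v; rewrite cov0.
  by apply/forallP => e; apply/implyP => /z0 ->; case/andP: (x02 e).
case: (arg_minnP (fun P : {set route T} => #|P|) good0) => P.
case/andP => /forallP covb /forallP leb minP.
have cov : covers_once P by move=> v; apply/eqP.
have lePx (e : edge T) : None \notin val e -> plan_vector P e <= x e.
  by move=> e0; apply: (implyP (leb e)).
exists P => //.
have eqPx (e : edge T) : None \notin val e -> x e = plan_vector P e.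
  move=> e0; apply/eqP; rewrite eq_le lePx // andbT leNgt; apply/negP => lt_e.
  have /cards2P[a [b [neqab eE]]] := valP e.
  case: a b neqab eE => [u|] [v|] // neqab eE;
    try by rewrite eE !inE ?eqxx ?orbT in e0.
  have ue : Some u \in val e by rewrite eE !inE eqxx.
  have ve : Some v \in val e by rewrite eE !inE eqxx orbT.
  have [R1 P1 d1] := deficient_depot_edge x P e u xsub cov lePx e0 ue lt_e.
  have [R2 P2 d2] := deficient_depot_edge x P e v xsub cov lePx e0 ve lt_e.
  have [eqR|neqR] := eqVneq R1 R2.
    (* One route through both: a subtour of [x]. *)
    set S := route_customers R1.
    have in1 w R : char_route R (depot_edge w) != 0 ->
        w \in route_customers R.
      case/route_depot_edge=> [o /route_customersE -> [s ->]].
      by rewrite inE mem_rcons inE eqxx.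
    have uS : u \in S by exact: in1.
    have vS : v \in S by rewrite /S eqR; exact: in1.
    have S0 : S != set0 by apply/set0Pn; exists u.
    have eS : e \in edges_in (customers_in S).
      by rewrite inE eE subUset !sub1set !imset_f.
    have notN (e' : edge T) : e' \in edges_in (customers_in S) -> None \notin val e'.
      by rewrite inE => /subsetP e'S; apply/negP => /e'S/imsetP[].
    have lt_S : vsum (plan_vector P) (edges_in (customers_in S))
        < vsum x (edges_in (customers_in S)).
      rewrite /vsum [ltLHS](bigD1 e) //= [ltRHS](bigD1 e) //= ltr_leD //.
      by apply: ler_sum => e' /andP[/notN ? _]; exact: lePx.
    have := lt_le_trans lt_S (sub S S0).
    rewrite vsum_plan (bigD1 R1) //= {1}/char_route vsum_droute_inside => lt1.
    have : #|S| = size (stops (some_orientation R1)).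
      by rewrite -(card_uniqP (stops_uniq _)); apply: eq_card => w; rewrite inE.
    rewrite -nb_inside_walk ?stops_uniq ?stops_neq0 // => cS.
    move: lt1; rewrite cS -natr1 addrK ltNge -[leLHS]addr0 lerD2l.
    case/negP; apply: sumr_ge0 => R _; apply: sumr_ge0 => e' _.
    exact: char_route_ge0.
  (* Two routes: merging them gives a smaller plan. *)
  have [P' [cov' ltP' P'E]] := merge_routes P R1 R2 u v cov P1 P2 neqR d1 d2.
  suff /minP : good P' by rewrite leqNgt ltP'.
  apply/andP; split; first by apply/forallP => w; rewrite cov'.
  apply/forallP => e'; apply/implyP => e'0; rewrite P'E // -eE.
  (* By integrality the defect on [e] is at least 1. *)
  have [/val_inj->|] := eqVneq (val e') (val e); last by rewrite addr0 lePx.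
  have /intrP[m xE] := xint e; have /intrP[n PE] := plan_vector_int P e.
  by move: lt_e; rewrite xE PE ltr_int -lezD1 -(ler_int rat) intrD.
apply/ffunP => e; have [/depot_edge_of[v ->]|] := boolP (None \in val e); last exact: eqPx.
have := deg v; rewrite -(plan_degree P v cov) !vsum_cut.
rewrite (eq_bigr (plan_vector P)) => [/addIr//|e' /andP[_ ?]]; exact: eqPx.
Qed.

Lemma routing_plan_spec {T : finType} (x : edge_vector T) :
  X_sub x -> integral x ->
  covers_once (routing_plan x) /\ x = plan_vector (routing_plan x).
Proof.
move=> xsub xint; rewrite /routing_plan; case: pickP => [P|none].
  by case/andP => /routing_planP cov /eqP xE.
have [P /routing_planP cov xE] := exists_routing_plan _ xsub xint.
by have := none P; rewrite cov {1}xE eqxx.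
Qed.

(** * The recourse bound *)

Lemma sum_over_stops {T : finType} {V : nmodType} (o : droute T) (S : {set T})
    (f : T -> V) :
  \sum_(v in S) (if v \in stops o then f v else 0) = \sum_(v <- stops o | v \in S) f v.
Proof.
rewrite -big_mkcondr -[RHS]big_filter big_uniq ?filter_uniq ?stops_uniq //=.
by apply: eq_bigl => v; rewrite mem_filter.
Qed.

(** The sum of [demand_coverage_from] over the routes of the plan: the total
    number of runs of [S] is [|S| - x(E(S))]. *)
Lemma demand_coverage {T : finType} (S : {set T}) (C : rat) (d : T -> rat)
    (x : edge_vector T) (orient : route T -> droute T) :
  0 < C -> (forall v, 0 <= d v) -> X_sub x -> integral x ->
  (forall R, orient R \in val R) ->
  \sum_(v in S) d v <= C *
    ((\sum_(v in S) \sum_(R in routing_plan x)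
       (if v \in stops (orient R) then failures_from C d 0 (stops (orient R)) v
        else 0))%:R
     + #|S|%:R - vsum x (edges_in (customers_in S))).
Proof.
move=> C0 d0 xsub xint oR; have [cov xE] := routing_plan_spec x xsub xint.
set P := routing_plan x in cov xE *.
have inR R v : (v \in stops (orient R)) = (v \in route_customers R).
  by rewrite (route_customersE (oR R)) inE.
have sum1 (V : nmodType) (f : T -> V) :
    \sum_(R in P) \sum_(v <- stops (orient R) | v \in S) f v = \sum_(v in S) f v.
  under eq_bigr => R _ do rewrite -sum_over_stops.
  rewrite exchange_big; apply: eq_bigr => v _.
  under eq_bigr => R _ do rewrite inR -[f v]mulr1n -mulrb.
  by rewrite sumrMnr cov.
rewrite -sum1 {1}exchange_big.
have -> : #|S|%:R = \sum_(R in P) (count (mem S) (stops (orient R)))%:R :> rat.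
  rewrite -natr_sum -sum1_card -(sum1 _ (fun=> 1%N)).
  by congr (_ %:R); apply: eq_bigr => R _; rewrite sum1_count.
rewrite [in vsum x]xE vsum_plan natr_sum -big_split -sumrB mulr_sumr /=.
apply: ler_sum => R _; rewrite sum_over_stops (char_routeE (oR R)) vsum_droute_inside.
have us : uniq (None :: map Some (stops (orient R))).
  rewrite /= map_inj_uniq ?stops_uniq; last by move=> ? ? [].
  by rewrite andbT; apply/mapP=> -[].
have := demand_coverage_from S C d (stops (orient R)) 0 None C0 d0 (lexx 0) us.
suff -> : None \in customers_in S = false by rewrite addr0.
by apply/imsetP => -[].
Qed.

(** When [S] splits into [k'] runs, [demand_coverage] gives
    [d(S) <= C * (F + k')] for the number [F] of failures in [S]. The multiples of
    [C] counted by [fail] are below [d(S)], so there are at most [F + k' - 1] of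
    them. As a customer fails at most once, the [F] failures are at distinct
    customers of [S] and cost at least as much as the cheapest ones. *)
Lemma scenario_bound {T : finType} (I : vrpsd T) (S : {set T}) (k' : nat)
    (xi : 'I_(nb_scenarios I)) (x : edge_vector T)
    (orient : route T -> droute T) :
  (forall v, demand I xi v <= capacity I) -> (0 < k')%N ->
  (forall R, orient R \in val R) -> X_sub x -> integral x ->
  vsum x (edges_in (customers_in S)) = #|S|%:R - k'%:R ->
  L_scenario k' xi 0 S <=
    \sum_(v in S) 2 * depot_cost I v *
      (\sum_(R in routing_plan x)
         (if v \in stops (orient R)
          then failures_at xi (stops (orient R)) (index v (stops (orient R)))
          else 0))%:R.
Proof.
move=> dC k0 oR xsub xint tight.
have C0 := capacity_gt0 I.
pose m v := (\sum_(R in routing_plan x)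
         (if v \in stops (orient R)
          then failures_at xi (stops (orient R)) (index v (stops (orient R)))
          else 0))%N.
have fE s v : failures_at xi s (index v s)
    = failures_from (capacity I) (demand I xi) 0 s v.
  by rewrite /failures_at /failures_from !add0r.
have := demand_coverage S _ _ x orient C0 (demand_ge0 xi) xsub xint oR.
rewrite tight opprB addrACA subrr addr0 -natrD.
have -> : (\sum_(v in S) \sum_(R in routing_plan x)
       (if v \in stops (orient R)
        then failures_from (capacity I) (demand I xi) 0 (stops (orient R)) v
        else 0) = \sum_(v in S) m v)%N.
  by apply: eq_bigr => v _; apply: eq_bigr => R _; rewrite fE.
move=> cover; have [cov xE] := routing_plan_spec x xsub xint.
rewrite /L_scenario; set n := (_ - k')%N.
pose s := by_depot_cost I S.
have sum_s (V : nmodType) (f : T -> V) : \sum_(v in S) f v = \sum_(v <- s) f v.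
  rewrite -big_enum; apply: perm_big; by rewrite perm_sym perm_sort.
rewrite sum_s; apply: (sum_take_sorted_le _ _ m) => [v|v||].
- by rewrite mulr_ge0 // cost_ge0.
- rewrite -(cov v); apply: leq_sum => R _.
  rewrite (route_customersE (oR R)) inE; case: ifP => // vs; rewrite fE.
  by apply: failures_from_le1 => // w; rewrite demand_ge0 dC.
- have := sort_sorted (_ : total (fun u v => depot_cost I u <= depot_cost I v))
    (enum S); rewrite -/(by_depot_cost I S).
  move=> /(_ (fun u v => le_total _ _)); apply: sub_sorted => u v.
  by rewrite ler_pM2l.
rewrite -sum_s /n leq_subLR.
have D0 : 0 <= \sum_(u in S) demand I xi u by apply: sumr_ge0 => u _; exact: demand_ge0.
(* Without multiples of [C] below [d(S)], the truncated subtraction gives 0. *)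
have [->|f0] := posnP (fail (capacity I) 0 (\sum_(u in S) demand I xi u)).
  exact: leq_trans k0 (leq_addr _ _).
have := leqnn (fail (capacity I) 0 (\sum_(u in S) demand I xi u)).
rewrite {2}/fail add0r leq_nb_multiples // => lt1.
by have := lt_le_trans lt1 cover; rewrite mulrC ltr_pM2l // ltr_nat addnC.
Qed.

Theorem proposition2 (T : finType) (I : vrpsd T)
    (demand_le_capacity :
      forall (xi : 'I_(nb_scenarios I)) (v : T), demand I xi v <= capacity I)
    (orient : route T -> droute T)
    (orient_optimal : optimal_orientation I orient)
    (S : {set T}) (k' : nat) (k'_gt0 : (0 < k')%N) :
  (forall x : edge_vector T,
     X_cvrp I x -> integral x ->
     vsum x (edges_in (customers_in S)) = #|S|%:R - k'%:R ->
     L_bound I S k'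
       <= \sum_(R in routing_plan x) \sum_(v in S) Q_hat I orient R v)
  /\
  ((forall x : edge_vector T,
      X_cvrp I x -> integral x ->
      vsum x (edges_in (customers_in S)) <= #|S|%:R - k'%:R) ->
   recourse_lower_bound I orient S (X_tight I S k') (L_bound I S k')).
Proof.
have bound x : X_cvrp I x -> integral x ->
    vsum x (edges_in (customers_in S)) = #|S|%:R - k'%:R ->
    L_bound I S k'
      <= \sum_(v in S) \sum_(R in routing_plan x) Q_hat I orient R v.
  case=> xsub _ _ xint tight.
  have oR R : orient R \in val R by case: (orient_optimal R).
  have -> : \sum_(v in S) \sum_(R in routing_plan x) Q_hat I orient R v
      = \sum_xi prob I xi * \sum_(v in S) 2 * depot_cost I v *
          (\sum_(R in routing_plan x)
             (if v \in stops (orient R)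
              then failures_at xi (stops (orient R))
                     (index v (stops (orient R)))
              else 0))%:R.
    under [RHS]eq_bigr => xi _ do rewrite mulr_sumr.
    rewrite [RHS]exchange_big; apply: eq_bigr => v _ /=.
    under [RHS]eq_bigr => xi _ do rewrite natr_sum !mulr_sumr.
    rewrite [RHS]exchange_big; apply: eq_bigr => R _ /=.
    rewrite /Q_hat; case: ifP => _; last by rewrite big1 // => xi _; rewrite !mulr0.
    by rewrite mulr_sumr; apply: eq_bigr => xi _; rewrite mulrCA.
  apply: ler_sum => xi _; apply: ler_wpM2l; first exact: prob_ge0.
  exact: scenario_bound.
split=> [x xX xint tight|_]; first by rewrite exchange_big; exact: bound.
split=> [|x [] //|x [xX xint tight]]; last exact: bound.
apply: sumr_ge0 => xi _; rewrite mulr_ge0 ?prob_ge0 // sumr_ge0 // => v _.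
by rewrite mulr_ge0 // cost_ge0.
Qed.
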